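(* Let $K=\hat k_i$ be the Kalman gain of the SPEnKF at step $i$, let $R=\frac1N(\boldsymbol\xi_i\cdot\boldsymbol\xi_i)$ be the sample variance of the observation perturbations, and let $P$ be the random analysis variance obtained from the imaginary perturbed observations update, $P=rK+K^2(R-r)$. Then $$\mathbb{E}[P]=r\,\mathbb{E}[K],\qquad \operatorname{Var}(P)=r^2\operatorname{Var}(K)+\mathbb{E}[K^4]\,\mathbb{E}[(R-r)^2].$$ That is, $P$ has the same expected value as the square-root analysis variance $rK$ of the SPEnKF, but has the additional variance $\mathbb{E}[K^4]\,\mathbb{E}[(R-r)^2]$.
   Context: Let $m_0,m_1,\dots$ be nonzero reals, $r>0$, $p_0>0$, $N>1$, $\alpha=N/2$. The SPEnKF (Scalar Pedagogical Ensemble Kalman Filter) starts with a vector of anomalies $\mathbf a^{\mathrm f}_0\in\mathbb{R}^N$ with i.i.d. $\mathcal N(0,p_0)$ entries, and for $j\ge0$: $\hat p^{\mathrm f}_j=\frac1N(\mathbf a^{\mathrm f}_j\cdot\mathbf a^{\mathrm f}_j)$, $\hat k_j=\frac{\hat p^{\mathrm f}_j}{\hat p^{\mathrm f}_j+r}$, $\hat p^{\mathrm a}_j=(1-\hat k_j)\hat p^{\mathrm f}_j$ $(=r\hat k_j)$, $\mathbf a^{\mathrm a}_j=(\hat p^{\mathrm a}_j)^{1/2}(\hat p^{\mathrm f}_j)^{-1/2}\mathbf a^{\mathrm f}_j$, $\mathbf a^{\mathrm f}_{j+1}=m_j\mathbf a^{\mathrm a}_j$. At step $i$, given the SPEnKF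 forecast anomalies $\mathbf a^{\mathrm f}_i$, the imaginary perturbed observations update replaces the square-root analysis by $\mathbf a^{\mathrm a}_i=(1-\hat k_i)\mathbf a^{\mathrm f}_i+\mathrm{i}\,\hat k_i\boldsymbol\xi_i$, where $\mathrm{i}$ is the imaginary unit and $\boldsymbol\xi_i\in\mathbb{R}^N$ has i.i.d. $\mathcal N(0,r)$ entries independent of the anomalies. Its analysis variance is $P=\frac1N\left(\mathbf a^{\mathrm a}_i\cdot\overline{\mathbf a^{\mathrm a}_i}\right)=(1-\hat k_i)^2\hat p^{\mathrm f}_i+\hat k_i^2R=rK+K^2(R-r)$. Here $R\sim\Gamma(\alpha,\alpha/r)$ (shape, rate). *)

(* Defs.v *)
From HB Require Import structures.
From mathcomp Require Import all_boot all_order all_algebra.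
From mathcomp Require Import complex.
From mathcomp Require Import all_classical all_reals all_analysis.

Set Implicit Arguments.
Unset Strict Implicit.
Unset Printing Implicit Defensive.

Import Order.TTheory GRing.Theory Num.Theory.

Local Open Scope classical_set_scope.
Local Open Scope ring_scope.

Section Independence.
Context d (T : measurableType d) (R : realType) (Pr : probability T R).

(* Taking some of the [B i] equal to [setT] gives the product rule for every
   subfamily. *)
Definition mutually_independent (I : finType) d' (S : measurableType d')
    (X : I -> T -> S) : Prop :=
  forall B : I -> set S, (forall i, measurable (B i)) ->
    Pr [set w | forall i, B i (X i w)] = (\prod_(i : I) Pr (X i @^-1` B i))%E.

Definition independent d1 d2 (S1 : measurableType d1) (S2 : measurableType d2)
    (X : T -> S1) (Y : T -> S2) : Prop :=
  forall (A : set S1) (B : set S2), measurable A -> measurable B ->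
    Pr (X @^-1` A `&` Y @^-1` B) = (Pr (X @^-1` A) * Pr (Y @^-1` B))%E.

(* The parameter [v] is the variance; [normal_prob] takes the standard
   deviation. *)
Definition iid_normal (N : nat) (v : R) (X : T -> N.-tuple R) : Prop :=
  mutually_independent (fun (j : 'I_N) w => tnth (X w) j) /\
  forall (j : 'I_N) (B : set R), measurable B ->
    Pr ((fun w => tnth (X w) j) @^-1` B) = normal_prob 0 (Num.sqrt v) B.

End Independence.

Section Filter.
Context (R : realType) (N : nat).
Implicit Types (r : R) (a xi : N.-tuple R).

Definition sample_var a : R := (\sum_(j < N) tnth a j * tnth a j) / N%:R.

Definition gain r a : R := sample_var a / (sample_var a + r).

Definition analysis_var r a : R := (1 - gain r a) * sample_var a.

Definition scale_anomalies (c : R) a : N.-tuple R :=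
  [tuple c * tnth a j | j < N].

Definition sqrt_analysis r a : N.-tuple R :=
  scale_anomalies (Num.sqrt (analysis_var r a) * (Num.sqrt (sample_var a))^-1) a.

Fixpoint forecast r (m : nat -> R) (i : nat) a : N.-tuple R :=
  match i with
  | 0 => a
  | j.+1 => scale_anomalies (m j) (sqrt_analysis r (forecast r m j a))
  end.

Local Open Scope complex_scope.

Definition ipo_analysis r a xi : N.-tuple R[i] :=
  [tuple ((1 - gain r a) * tnth a j) +i* (gain r a * tnth xi j) | j < N].

(* [z . conj z] is a nonnegative real, so [Re] only changes its type. *)
Definition complex_sample_var (z : N.-tuple R[i]) : R :=
  complex.Re ((\sum_(j < N) tnth z j * conjc (tnth z j)) / N%:R).

End Filter.

(* Main.v *)
(** Writing [K] for the gain and [R] for the sample variance of the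
    perturbations, [P = r K + K^2 (R - r)].  The forecast, hence [K], is
    independent of [R], and [E[R] = r], so [E[K^n (R - r)] = 0] for all [n].
    With [n = 2] this gives the mean of [P]; with [n = 2] and [n = 3] it kills
    the cross term of [(r (K - E[K]) + K^2 (R - r))^2], which leaves
    [r^2 Var(K) + E[K^4] E[(R - r)^2]].  Independence enters through Tonelli's
    theorem for the product law, and [E[R] = r] through the second moment of
    the normal law, an integration by parts on [[-n, n]]. *)

Require Import Defs.
From HB Require Import structures.
From mathcomp Require Import all_boot all_order all_algebra.
From mathcomp Require Import complex.
From mathcomp Require Import all_classical all_reals all_analysis.
From mathcomp Require Import measurable_realfun ring lra.

Set Implicit Arguments.
Unset Strict Implicit.
Unset Printing Implicit Defensive.

Import Order.TTheory GRing.Theory Num.Theory.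
Import numFieldNormedType.Exports.

Local Open Scope ring_scope.

(** * Integrals under independence and under a normal law *)

Lemma ge0_integral_independent d d1 d2 (T : measurableType d)
    (S1 : measurableType d1) (S2 : measurableType d2) (R : realType)
    (P : probability T R) (X : {RV P >-> S1}) (Y : {RV P >-> S2})
    (f : S1 -> \bar R) (g : S2 -> \bar R) :
    independent P X Y -> measurable_fun setT f -> measurable_fun setT g ->
    (forall x, 0 <= f x)%E -> (forall y, 0 <= g y)%E ->
  (\int[P]_w (f (X w) * g (Y w)) =
     (\int[P]_w f (X w)) * (\int[P]_w g (Y w)))%E.
Proof.
move=> indXY mf mg f0 g0.
have mXY : measurable_fun setT (fun w => (X w, Y w)).
  by apply: measurable_fun_pair; exact: measurable_funP.
pose XY : {RV P >-> (S1 * S2)%type} := mfun_Sub (mem_set mXY).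
pose h (z : S1 * S2) := (f z.1 * g z.2)%E.
have mh : measurable_fun setT h.
  by apply: emeasurable_funM; exact: measurableT_comp.
have h0 z : (0 <= h z)%E by rewrite mule_ge0.
transitivity (\int[distribution P XY]_z h z)%E.
  by rewrite ge0_integral_distribution.
transitivity (\int[distribution P X \x distribution P Y]_z h z)%E.
  (* Independence says that the joint law and the product of the marginal laws agree on rectangles,
     and this agreement determines the measure on the product. *)
  apply: eq_measure_integral => A mA _; apply/esym.
  apply: product_measure_unique => // B C mB mC.
rewrite fubini_tonelli1// /fubini_F /h /=.
under eq_integral do rewrite ge0_integralZl//.
rewrite ge0_integralZr//; last exact: integral_ge0.
by rewrite !ge0_integral_distribution.
Qed.

(** [normal_pdf] and the Radon-Nikodym derivative of [normal_prob] have the same integral over every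
    measurable set, so they agree almost everywhere; the change of variables known for the
    derivative then holds for the density. *)
Lemma ge0_integral_normal_prob (R : realType) (m s : R) (f : R -> \bar R) :
  measurable_fun setT f -> (forall x, 0 <= f x)%E ->
  (\int[normal_prob m s]_x f x =
     \int[lebesgue_measure]_x (f x * (normal_pdf m s x)%:E))%E.
Proof.
move=> mf f0.
have dom := normal_prob_dominates m s.
rewrite -(Radon_Nikodym_SigmaFinite.change_of_variables dom)//.
apply: ae_eq_integral => //.
- apply: emeasurable_funM => //.
  exact: measurable_int (Radon_Nikodym_SigmaFinite.f_integrable dom).
- apply: emeasurable_funM => //.
  by apply/measurable_EFinP; exact: measurable_normal_pdf.
- apply: ae_eqe_mul2l; apply: integral_ae_eq => //.
  + exact: Radon_Nikodym_SigmaFinite.f_integrable dom.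
  + by apply/measurable_EFinP; exact: measurable_normal_pdf.
  + by move=> A _ mA; rewrite -Radon_Nikodym_SigmaFinite.f_integral.
Qed.

(** * Second moment of the centered normal law *)

Section normal_second_moment.
Variables (R : realType) (s : R).
Hypothesis s_neq0 : s != 0.
Local Notation mu := (@lebesgue_measure R).
Local Notation pdf := (normal_pdf 0 s).
Local Open Scope classical_set_scope.

(** Provides the primitive of [x * pdf x] for the integration by parts; it comes from
    [pdf' x = - x / s ^+ 2 * pdf x]. *)
Lemma is_derive_normal_pdf (x : R) :
  is_derive x 1 (fun y : R => - s ^+ 2 * pdf y) (x * pdf x).
Proof.
rewrite normal_pdfE// /normal_fun.
apply: is_derive_eq.
rewrite /GRing.scale/= subr0.
set e := expR _.
by field.
Qed.

(** Follows from [t <= 1 + t <= expR t] at [t = x ^+ 2 / (s ^+ 2 *+ 2)]. Quadratic decay is enough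
    to make the boundary term [n * pdf n] vanish in the limit. *)
Lemma normal_pdf_le (x : R) :
  x != 0 -> pdf x <= normal_peak s * (s ^+ 2 *+ 2 / x ^+ 2).
Proof.
move=> x0; rewrite normal_pdfE// ler_wpM2l ?normal_peak_ge0// /normal_fun subr0.
rewrite mulNr expRN -[leRHS]invf_div lef_pV2 ?posrE ?expR_gt0//; last first.
  by rewrite divr_gt0 ?pmulrn_lgt0 ?exprn_even_gt0.
by apply: le_trans (expR_ge1Dx _); rewrite lerDr.
Qed.

Lemma normal_pdfN (x : R) : pdf (- x) = pdf x.
Proof. by rewrite !normal_pdfE// /normal_fun !subr0 sqrrN. Qed.

(** Monotone convergence: the intervals increase to the whole line. It carries results from compact
    intervals, where integration by parts applies, to the line. *)
Lemma cvg_integral_symmetric_itv (f : R -> R) :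
  measurable_fun setT f -> (forall x, 0 <= f x) ->
  (\int[mu]_(x in `[(- n%:R)%R, n%:R]) (f x)%:E)%E @[n --> \oo] -->
    (\int[mu]_x (f x)%:E)%E.
Proof.
move=> mf f0; rewrite -[X in integral _ X](bigcup_itvT true false).
apply: ge0_nondecreasing_set_cvg_integral.
- move=> m n mn; apply/subsetPset/subset_itv; rewrite bnd_simp.
    by rewrite lerN2 ler_nat.
  by rewrite ler_nat.
- by move=> n; exact: measurable_itv.
- by move=> n; apply: measurable_funTS; apply/measurable_EFinP.
- by move=> n x _; rewrite lee_fin.
Qed.

Lemma integral_sqr_normal_pdf :
  (\int[mu]_x (x ^+ 2 * pdf x)%:E = (s ^+ 2)%:E)%E.
Proof.
have cpdf : continuous pdf := continuous_normal_pdf s_neq0.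
have mpdf : measurable_fun setT pdf := measurable_normal_pdf 0 s.
have Dpdf x := is_derive_normal_pdf x.
(* The integrand is read as [x] times [x * pdf x]. Since [pdf] is even, the two endpoints contribute
   equally, whence the factor 2 in the boundary term. *)
have parts (n : nat) : (0 < n)%N ->
    (\int[mu]_(x in `[(- n%:R)%R, n%:R]) (x ^+ 2 * pdf x)%:E =
     (- (s ^+ 2 *+ 2) * (n%:R * pdf n%:R))%:E
     + (s ^+ 2)%:E * \int[mu]_(x in `[(- n%:R)%R, n%:R]) (pdf x)%:E)%E.
  move=> n0.
  have n0' : 0 < n%:R :> R by rewrite ltr0n.
  under eq_integral do rewrite expr2 -mulrA.
  rewrite (@integration_by_parts R id (fun y => - s ^+ 2 * pdf y) (cst 1)
    (fun x => x * pdf x)).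
  - rewrite normal_pdfN; congr (_ + _)%E; first by congr EFin; ring.
    under eq_integral do rewrite mul1r EFinM.
    rewrite integralZl//.
      by rewrite EFinN mulNe oppeK.
    apply: (integrableS measurableT) => //.
    exact: integrable_normal_pdf.
  - by rewrite gtrN.
  - by move=> x; exact: cvg_cst.
  - split => [x _| |]; first exact: derivable_id.
      by apply: (@cvg_at_right_filter _ _ id); exact: cvg_id.
    by apply: (@cvg_at_left_filter _ _ id); exact: cvg_id.
  - by move=> x _; rewrite derive1E derive_id.
  - apply: continuous_subspaceT => x.
    apply: cvgM; [exact: cvg_id|exact: cpdf].
  - have cG : continuous (fun y : R => - s ^+ 2 * pdf y).
      by move=> x; apply: cvgM; [exact: cvg_cst|exact: cpdf].
    split => [x _| |].
    + by have [] := Dpdf x.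
    + exact/cvg_at_right_filter/cG.
    + exact/cvg_at_left_filter/cG.
  - by move=> x _; rewrite derive1E derive_val.
have boundary : n%:R * pdf n%:R @[n --> \oo] --> (0 : R).
  apply: (@squeeze_cvgr _ _ _ _ (cst 0)
    (fun n : nat => normal_peak s * (s ^+ 2 *+ 2) / n%:R)).
  - near=> n; have n0 : 0 < n%:R :> R by rewrite ltr0n; near: n; exact: nbhs_infty_gt.
    rewrite mulr_ge0 ?normal_pdf_ge0//=.
    apply: le_trans (ler_wpM2l (ltW n0) (normal_pdf_le (lt0r_neq0 n0))) _.
    rewrite le_eqVlt; apply/orP; left; apply/eqP.
    by field; rewrite gt_eqF.
  - exact: cvg_cst.
  - rewrite -[X in _ --> X](mulr0 (normal_peak s * (s ^+ 2 *+ 2))).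
    apply: cvgM; first exact: cvg_cst.
    apply/gtr0_cvgV0; last exact: cvgr_idn.
    by near=> n; rewrite ltr0n; near: n; exact: nbhs_infty_gt.
(* The truncated integrals have two limits that must coincide: the full integral, and, by [parts],
   [0 + s ^+ 2 * 1], the density having total mass 1. *)
transitivity (limn (fun n : nat =>
    \int[mu]_(x in `[(- n%:R)%R, n%:R]) (x ^+ 2 * pdf x)%:E)%E).
- apply/esym/cvg_lim => //.
  apply: (@cvg_integral_symmetric_itv (fun x => x ^+ 2 * pdf x)).
    by apply: measurable_funM.
  by move=> x; rewrite mulr_ge0 ?sqr_ge0 ?normal_pdf_ge0.
- apply/cvg_lim => //.
  have : ((- (s ^+ 2 *+ 2) * (n%:R * pdf n%:R))%:E
      + (s ^+ 2)%:E * \int[mu]_(x in `[(- n%:R)%R, n%:R]) (pdf x)%:E)%E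
      @[n --> \oo] --> (s ^+ 2)%:E.
    rewrite -[X in _ --> X]add0e; apply: cvgeD => //.
      apply: cvg_EFin; first by near=> n.
      rewrite -[X in _ --> X](mulr0 (- (s ^+ 2 *+ 2))).
      exact: (cvgM (cvg_cst _) boundary).
    rewrite -[X in _ --> X]mule1 -(integral_normal_pdf 0 s).
    apply: cvgeZl => //.
    by apply: cvg_integral_symmetric_itv => //; exact: normal_pdf_ge0.
  apply: cvg_trans; apply: near_eq_cvg; near=> n; rewrite parts//.
  by near: n; exact: nbhs_infty_gt.
Unshelve. all: by end_near. Qed.

End normal_second_moment.

Lemma integral_sqr_normal_prob (R : realType) (s : R) : s != 0 ->
  (\int[normal_prob 0 s]_x (x ^+ 2)%:E = (s ^+ 2)%:E)%E.
Proof.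
move=> s0; rewrite ge0_integral_normal_prob//.
- by rewrite -integral_sqr_normal_pdf//; under eq_integral do rewrite -EFinM.
- by apply/measurable_EFinP; exact: measurable_funX.
- by move=> x; rewrite lee_fin sqr_ge0.
Qed.

Lemma integral_sqr_normal_law d (T : measurableType d) (R : realType)
    (P : probability T R) (X : T -> R) (s : R) :
  measurable_fun setT X -> s != 0 ->
  (forall B : set R, measurable B -> P (X @^-1` B)%classic = normal_prob 0 s B) ->
  (\int[P]_w (X w ^+ 2)%:E = (s ^+ 2)%:E)%E.
Proof.
move=> mX s0 lawX.
(* [normal_prob] lives on the copy of [R] carrying the Lebesgue-Stieltjes
   sigma-algebra, so [X] is first viewed as a variable with values there. *)
pose S : measurableType _ := g_sigma_algebraType R.-ocitv.-measurable.
have mXS : measurable_fun (U := S) setT X by exact: mX.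
pose XS : {RV P >-> S} := @mfun_Sub _ _ T S X (mem_set mXS).
have msqr : measurable_fun setT (fun x : S => ((x : R) ^+ 2)%:E).
  by apply/measurable_EFinP; exact: measurable_funX.
rewrite -integral_sqr_normal_prob//.
transitivity (\int[distribution P XS]_x ((x : R) ^+ 2)%:E)%E.
  by rewrite ge0_integral_distribution// => x; rewrite lee_fin sqr_ge0.
by apply: eq_measure_integral => B mB _; exact: lawX.
Qed.

(** * Additivity of integrals and scaling of variances when some integrals may be infinite *)

Lemma ge0_integralD_integrable d (T : measurableType d) (R : realType)
    (mu : {measure set T -> \bar R}) (u v : T -> R) :
  mu.-integrable setT (EFin \o u) -> measurable_fun setT v ->
  (forall x, 0 <= v x) -> (forall x, 0 <= u x + v x) ->
  (\int[mu]_x (u x + v x)%:E =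
     \int[mu]_x (u x)%:E + \int[mu]_x (v x)%:E)%E.
Proof.
move=> iu mv v0 uv0.
have mEu : measurable_fun setT (EFin \o u) := measurable_int _ iu.
have mu' : measurable_fun setT u by apply/measurable_EFinP.
pose up := (EFin \o u)^\+%E; pose un := (EFin \o u)^\-%E.
have fin_un : (\int[mu]_x un x)%E \is a fin_num.
  by apply: integrable_fin_num => //; exact: integrable_funeneg.
(* Moving the negative part [un] of [u] across leaves only nonnegative integrands, so additivity
   holds even if [v] has infinite integral. The integral of [un] is finite and is cancelled
   afterwards. *)
have split_sum : (\int[mu]_x (u x + v x)%:E + \int[mu]_x un x =
    \int[mu]_x up x + \int[mu]_x (v x)%:E)%E.
  rewrite -!ge0_integralD//.
  - apply: eq_integral => x _.
    rewrite /up /un funeposE funenegE /= -!EFin_max -!EFinD.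
    by congr EFin; case: (leP (u x) 0) => ?; case: (leP (- u x) 0) => ?; lra.
  - by move=> x _; exact: funepos_ge0.
  - exact: measurable_funepos.
  - by move=> x _; rewrite lee_fin.
  - exact/measurable_EFinP.
  - by move=> x _; rewrite lee_fin.
  - by apply/measurable_EFinP; exact: measurable_funD.
  - by move=> x _; exact: funeneg_ge0.
  - exact: measurable_funeneg.
rewrite -[LHS](addeK _ fin_un) split_sum [in RHS]integralE.
by rewrite addeAC.
Qed.

Lemma variance_integral d (T : measurableType d) (R : realType)
    (P : probability T R) (X : T -> R) :
  ('V_P[X] = \int[P]_w ((X w - fine 'E_P[X]) ^+ 2)%:E)%E.
Proof.
(* The mean is generalized first, so that unlocking the expectation reaches only the outer
   integral. *)
by rewrite /variance covariance.unlock; move: (fine _) => e; rewrite expectation.unlock.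
Qed.

Lemma expectation_scale d (T : measurableType d) (R : realType)
    (P : probability T R) (c : R) (X : T -> R) :
  P.-integrable setT (EFin \o X) ->
  ('E_P[fun w => (c * X w)%R] = c%:E * 'E_P[X])%E.
Proof. by move=> iX; rewrite expectation.unlock -integralZl. Qed.

(* [varianceZ] without square integrability. *)
Lemma variance_scale d (T : measurableType d) (R : realType)
    (P : probability T R) (c : R) (X : T -> R) :
  P.-integrable setT (EFin \o X) ->
  ('V_P[fun w => (c * X w)%R] = (c ^+ 2)%:E * 'V_P[X])%E.
Proof.
move=> iX.
have mX : measurable_fun setT X.
  by apply/measurable_EFinP; exact: measurable_int iX.
have finE : 'E_P[X]%E \is a fin_num.
  by apply: expectation_fin_num; exact/Lfun1_integrable.
rewrite !variance_integral expectation_scale// fineM//=.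
rewrite -ge0_integralZl ?lee_fin ?sqr_ge0//.
- by apply: eq_integral => w _; rewrite -EFinM -mulrBr exprMn.
- apply/measurable_EFinP; apply: measurable_funX.
  by apply: measurable_funB.
- by move=> w _; rewrite lee_fin sqr_ge0.
Qed.

(** * Mean and variance of [c * F + F ^+ 2 * (G - c)] for independent [F] in the unit interval and
    [G] of mean [c] *)

Section multiplicative_noise.
Context d d1 d2 (T : measurableType d) (S1 : measurableType d1)
  (S2 : measurableType d2) (R : realType).
Variables (P : probability T R) (X : {RV P >-> S1}) (Y : {RV P >-> S2}).
Variables (f : S1 -> R) (g : S2 -> R) (c : R).
Hypothesis indXY : independent P X Y.
Hypotheses (mf : measurable_fun setT f) (mg : measurable_fun setT g).
Hypotheses (f01 : forall x, 0 <= f x <= 1) (g0 : forall y, 0 <= g y).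
Hypothesis EgY : ('E_P[fun w => g (Y w)] = c%:E)%E.

Let F w := f (X w).
Let G w := g (Y w).

Let mF : measurable_fun setT F. Proof. exact: measurableT_comp. Qed.
Let mG : measurable_fun setT G. Proof. exact: measurableT_comp. Qed.
Let F0 w : 0 <= F w. Proof. by have /andP[] := f01 (X w). Qed.
Let F1 w : F w <= 1. Proof. by have /andP[] := f01 (X w). Qed.

Let integralG : (\int[P]_w (G w)%:E = c%:E)%E.
Proof. by rewrite -EgY expectation.unlock. Qed.

Let integrableG : P.-integrable setT (EFin \o G).
Proof.
apply/integrableP; split; first exact/measurable_EFinP.
under eq_integral do rewrite /= ger0_norm ?g0//.
by rewrite integralG ltry.
Qed.

Let Fn1 n w : F w ^+ n <= 1.
Proof. by rewrite exprn_ile1. Qed.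

(** The powers are dominated by the constant 1, integrable under a probability. *)
Lemma integrable_pow_bounded n : P.-integrable setT (fun w => (F w ^+ n)%:E).
Proof.
apply: (le_integrable measurableT _ _ (finite_measure_integrable_cst P 1 measurableT)).
  by apply/measurable_EFinP; exact: measurable_funX.
by move=> w _ /=; rewrite lee_fin normr1 ger0_norm ?exprn_ge0.
Qed.

Let integrable_powM n : P.-integrable setT (fun w => (F w ^+ n * G w)%:E).
Proof.
apply: (le_integrable measurableT _ _ integrableG).
  by apply/measurable_EFinP; apply: measurable_funM => //; exact: measurable_funX.
move=> w _ /=; rewrite lee_fin normrM ler_piMl//.
by rewrite ger0_norm ?exprn_ge0.
Qed.

Lemma integrable_pow_centered n :
  P.-integrable setT (fun w => (F w ^+ n * (G w - c))%:E).
Proof.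
have -> : (fun w => (F w ^+ n * (G w - c))%:E) =
    ((fun w => (F w ^+ n * G w)%:E) \- (fun w => c%:E * (F w ^+ n)%:E))%E.
  by apply/funext => w; congr EFin; rewrite /G /F; ring.
apply: integrableB => //; apply: integrableZl => //.
exact: integrable_pow_bounded.
Qed.

(** The product rule asks for nonnegative factors and [G - c] may change sign, so [F ^+ n * G] and
    [c * F ^+ n] are integrated separately; independence gives the first the mean [c] times that of
    [F ^+ n], and they cancel. *)
Lemma integral_pow_centered n :
  (\int[P]_w (F w ^+ n * (G w - c))%:E = 0)%E.
Proof.
have iF := integrable_pow_bounded n.
have finF : (\int[P]_w (F w ^+ n)%:E)%E \is a fin_num.
  exact: integrable_fin_num iF.
under eq_integral => w _.
  rewrite (_ : (_ * _)%:E = (F w ^+ n * G w)%:E - c%:E * (F w ^+ n)%:E)%E;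
    last by rewrite -EFinM -EFinB; congr EFin; ring.
  over.
rewrite integralB//=; last exact: integrableZl.
rewrite integralZl//.
rewrite (@ge0_integral_independent _ _ _ _ _ _ _ P X Y
  (fun x => (f x ^+ n)%:E) (fun y => (g y)%:E))//.
- by rewrite integralG muleC subee// fin_numM.
- by apply/measurable_EFinP; exact: measurable_funX.
- exact/measurable_EFinP.
- by move=> x; rewrite lee_fin exprn_ge0//; have /andP[] := f01 x.
Qed.

Let Z w := c * F w + F w ^+ 2 * (G w - c).

Lemma expectation_multiplicative_noise : ('E_P[Z] = c%:E * 'E_P[F])%E.
Proof.
rewrite expectation.unlock /Z.
under eq_integral do rewrite EFinD EFinM.
rewrite integralD//; last 2 first.
  by apply: integrableZl => //; exact: (integrable_pow_bounded 1).
  exact: integrable_pow_centered.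
by rewrite integral_pow_centered adde0 integralZl//; exact: (integrable_pow_bounded 1).
Qed.

Lemma variance_multiplicative_noise :
  ('V_P[Z] = (c ^+ 2)%:E * 'V_P[F] +
     'E_P[fun w => (F w ^+ 4)%R] * 'E_P[fun w => ((G w - c) ^+ 2)%R])%E.
Proof.
(* [F w ^+ 1] is convertible to [F w]. *)
have iF : P.-integrable setT (EFin \o F) := integrable_pow_bounded 1.
have finE : 'E_P[F]%E \is a fin_num.
  by apply: expectation_fin_num; exact/Lfun1_integrable.
(* The first term is folded into the variance of [c * F], so that both sides are squares centered at
   the same number [c * e]. *)
rewrite -variance_scale// !variance_integral expectation_multiplicative_noise.
rewrite expectation_scale// fineM//=; set e := fine _.
(* [U] is integrable, its cross terms having mean 0, whereas the nonnegative
   [V] is never shown to be integrable. *)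
pose U w := (c * F w - c * e) ^+ 2 +
  (c *+ 2 * (F w ^+ 3 * (G w - c)) - c * e *+ 2 * (F w ^+ 2 * (G w - c))).
pose V w := F w ^+ 4 * (G w - c) ^+ 2.
have ZE w : (Z w - c * e) ^+ 2 = U w + V w by rewrite /Z /U /V; ring.
have iU1 : P.-integrable setT (fun w => ((c * F w - c * e) ^+ 2)%:E).
  have -> : (fun w => ((c * F w - c * e) ^+ 2)%:E) =
     (fun w => (c ^+ 2)%:E * (F w ^+ 2)%:E + ((- (c ^+ 2 * e *+ 2))%:E * (F w)%:E
        + ((c * e) ^+ 2)%:E))%E.
    by apply/funext => w; rewrite -!EFinM -!EFinD; congr EFin; ring.
  apply: integrableD => //.
    by apply: integrableZl => //; exact: integrable_pow_bounded.
  apply: integrableD => //; first exact: integrableZl.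
  exact: finite_measure_integrable_cst.
have iC k n : P.-integrable setT (fun w => (k * (F w ^+ n * (G w - c)))%:E).
  under eq_fun do rewrite EFinM.
  by apply: integrableZl => //; exact: integrable_pow_centered.
have iC0 k n : (\int[P]_w (k * (F w ^+ n * (G w - c)))%:E = 0)%E.
  under eq_integral do rewrite EFinM.
  rewrite integralZl ?integral_pow_centered ?mule0//.
  exact: integrable_pow_centered.
have iCB : P.-integrable setT (fun w => (c *+ 2 * (F w ^+ 3 * (G w - c)) -
    c * e *+ 2 * (F w ^+ 2 * (G w - c)))%:E).
  by under eq_fun do rewrite EFinB; exact: integrableB.
have mGc : measurable_fun setT (fun w => (G w - c) ^+ 2).
  by apply: measurable_funX; exact: measurable_funB.
under eq_integral do rewrite ZE.
rewrite ge0_integralD_integrable; first last.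
(* [U] alone may be negative, but [U + V] is the square being integrated. *)
- by move=> w; rewrite -ZE sqr_ge0.
- by move=> w; rewrite mulr_ge0 ?sqr_ge0 ?exprn_ge0.
- by apply: measurable_funM => //; exact: measurable_funX.
- rewrite (_ : _ \o _ = (fun w => ((c * F w - c * e) ^+ 2)%:E +
    (c *+ 2 * (F w ^+ 3 * (G w - c)) - c * e *+ 2 * (F w ^+ 2 * (G w - c)))%:E)%E).
    exact: integrableD.
  by apply/funext => w /=; rewrite EFinD.
congr (_ + _)%E.
- under eq_integral do rewrite EFinD.
  rewrite integralD// [X in (_ + X)%E](_ : _ = 0%E) ?adde0//.
  under eq_integral do rewrite EFinB.
  by rewrite integralB// !iC0 sube0.
(* Both factors of [V] are nonnegative, so independence splits the integral even if the second
   moment of [G - c] is infinite. *)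
- under eq_integral do rewrite EFinM.
  rewrite (@ge0_integral_independent _ _ _ _ _ _ _ P X Y
    (fun x => (f x ^+ 4)%:E) (fun y => ((g y - c) ^+ 2)%:E))//.
  + by rewrite !expectation.unlock.
  + by apply/measurable_EFinP; exact: measurable_funX.
  + apply/measurable_EFinP; apply: measurable_funX.
    exact: measurable_funB.
  + by move=> x; rewrite lee_fin exprn_ge0//; have /andP[] := f01 x.
  + by move=> y; rewrite lee_fin sqr_ge0.
Qed.

End multiplicative_noise.

(** * Algebra of the gain and of the analysis variances *)

Section filter.
Variables (R : realType) (N : nat).
Implicit Types (r : R) (a xi : N.-tuple R).

Lemma sample_varE a : sample_var a = (\sum_(j < N) tnth a j ^+ 2) / N%:R.
Proof. by []. Qed.

Lemma sample_var_ge0 a : 0 <= sample_var a.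
Proof. by rewrite sample_varE divr_ge0// sumr_ge0// => j _; rewrite sqr_ge0. Qed.

Lemma sample_varD_gt0 r a : 0 < r -> 0 < sample_var a + r.
Proof. exact: ltr_wpDl (sample_var_ge0 a). Qed.

Lemma gain_itv r a : 0 < r -> 0 <= gain r a <= 1.
Proof.
move=> r0; apply/andP; split.
  by rewrite divr_ge0 ?sample_var_ge0// ltW ?sample_varD_gt0.
by rewrite ler_pdivrMr ?sample_varD_gt0// mul1r lerDl ltW.
Qed.

(** With [v] the sample variance, [1 - v / (v + r) = r / (v + r)], and [v + r] is positive. *)
Lemma analysis_varE r a : 0 < r -> analysis_var r a = r * gain r a.
Proof.
move=> r0; rewrite /analysis_var /gain; field.
by rewrite gt_eqF// sample_varD_gt0.
Qed.

(** Each product with the conjugate is an embedded real. The embedding [real_complex] is a field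
    morphism, so it passes through the sum and the division, and [Re] undoes it. *)
Lemma complex_sample_varE (x y : 'I_N -> R) :
  complex_sample_var [tuple Complex (x j) (y j) | j < N] =
    (\sum_(j < N) (x j ^+ 2 + y j ^+ 2)) / N%:R.
Proof.
rewrite /complex_sample_var.
under eq_bigr => j _.
  rewrite tnth_mktuple
    (_ : _ * _ = real_complex R (x j ^+ 2 + y j ^+ 2)); last first.
    by apply/eqP; rewrite eq_complex /=; apply/andP; split; apply/eqP; ring.
  over.
by rewrite -rmorph_sum -(rmorph_nat (real_complex R)) -fmorph_div.
Qed.

(** The perturbation sits in the imaginary part, so the squared modulus has no cross term between
    [a] and [xi]; hence the identity holds pointwise. *)
Lemma ipo_analysis_varE r a xi : 0 < r ->
  complex_sample_var (ipo_analysis r a xi) =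
    r * gain r a + gain r a ^+ 2 * (sample_var xi - r).
Proof.
move=> r0; rewrite complex_sample_varE.
have := analysis_varE a r0; rewrite /analysis_var.
move: (gain r a) => k kE.
(* One factor [1 - k] is kept next to [sample_var a] so that [kE] turns that product into
   [r * k]. *)
transitivity ((1 - k) * ((1 - k) * sample_var a) + k ^+ 2 * sample_var xi).
  under eq_bigr do rewrite !exprMn.
  by rewrite big_split/= -!mulr_sumr !sample_varE; ring.
by rewrite kE; ring.
Qed.

Lemma measurable_sample_var : measurable_fun setT (@sample_var R N).
Proof.
apply: measurable_funM => //; apply: measurable_sum => j.
by apply: measurable_funM; exact: measurable_tnth.
Qed.

End filter.

(** * Measurability of the filter, and the mean of the perturbation variance *)

Section measurable_filter.
Variables (R : realType) (N : nat).

(** On nonnegative reals the inverse is the power of exponent -1, including at 0, where both are 0.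
    That value matters for [sqrt_analysis], whose sample variance can vanish. *)
Lemma measurable_inv_ge0 d (T : measurableType d) (f : T -> R) :
  measurable_fun setT f -> (forall x, 0 <= f x) ->
  measurable_fun setT (fun x => (f x)^-1).
Proof.
move=> mf f0; under eq_fun do rewrite -powR_inv1//.
exact: measurableT_comp (measurable_powR _) mf.
Qed.

Lemma measurable_sqrt d (T : measurableType d) (f : T -> R) :
  measurable_fun setT f -> measurable_fun setT (fun x => Num.sqrt (f x)).
Proof.
apply: measurableT_comp; apply: continuous_measurable_fun.
exact: sqrt_continuous.
Qed.

Lemma measurable_gain (r : R) : 0 < r -> measurable_fun setT (@gain R N r).
Proof.
move=> r0; apply: measurable_funM; first exact: measurable_sample_var.
apply: measurable_inv_ge0 => [|a]; last by rewrite ltW// sample_varD_gt0.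
by apply: measurable_funD => //; exact: measurable_sample_var.
Qed.

Lemma measurable_analysis_var (r : R) :
  0 < r -> measurable_fun setT (@analysis_var R N r).
Proof.
move=> r0; apply: measurable_funM; last exact: measurable_sample_var.
by apply: measurable_funB => //; exact: measurable_gain.
Qed.

Lemma measurable_scale_anomalies d (T : measurableType d) (c : T -> R)
    (a : T -> N.-tuple R) :
  measurable_fun setT c -> measurable_fun setT a ->
  measurable_fun setT (fun x => scale_anomalies (c x) (a x)).
Proof.
move=> mc ma; apply/measurable_fun_tnthP => j.
rewrite (_ : _ \o _ = fun x => c x * tnth (a x) j); last first.
  by apply/funext => x; rewrite /= tnth_mktuple.
by apply: measurable_funM => //; exact: measurableT_comp (measurable_tnth j) ma.
Qed.

Lemma measurable_sqrt_analysis (r : R) :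
  0 < r -> measurable_fun setT (@sqrt_analysis R N r).
Proof.
move=> r0; apply: measurable_scale_anomalies; last exact: measurable_id.
apply: measurable_funM.
  by apply: measurable_sqrt; exact: measurable_analysis_var.
apply: measurable_inv_ge0 => [|a]; last exact: sqrtr_ge0.
by apply: measurable_sqrt; exact: measurable_sample_var.
Qed.

Lemma measurable_forecast (r : R) (m : nat -> R) (i : nat) :
  0 < r -> measurable_fun setT (@forecast R N r m i).
Proof.
move=> r0; elim: i => [|i IH]; first exact: measurable_id.
apply: measurable_scale_anomalies; first exact: measurable_cst.
exact: measurableT_comp (measurable_sqrt_analysis r0) IH.
Qed.

(** By linearity: every entry has second moment [Num.sqrt r ^+ 2 = r], and the average of [N] copies
    of [r] is [r]. *)
Lemma expectation_sample_var d (T : measurableType d) (P : probability T R)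
    (r : R) (xi : {RV P >-> N.-tuple R}) : 0 < r -> (0 < N)%N ->
  iid_normal P r xi -> ('E_P[fun w => sample_var (xi w)] = r%:E)%E.
Proof.
move=> r0 N0 [_ xi_normal].
have mxi j : measurable_fun setT (fun w => tnth (xi w) j).
  by apply: measurableT_comp (measurable_tnth j) _; exact: measurable_funP.
have second_moment j : (\int[P]_w (tnth (xi w) j ^+ 2)%:E = r%:E)%E.
  have sqrtr_neq0 : Num.sqrt r != 0 by rewrite gt_eqF ?sqrtr_gt0.
  by rewrite (integral_sqr_normal_law (mxi j) sqrtr_neq0 (xi_normal j)) sqr_sqrtr// ltW.
rewrite expectation.unlock.
under eq_integral.
  by move=> w _; rewrite sample_varE mulrC EFinM -sumEFin; over.
rewrite ge0_integralZl//; last 2 first.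
- by apply: emeasurable_sum => j; apply/measurable_EFinP; exact: measurable_funX.
- by move=> w _; apply: sume_ge0 => j _; rewrite lee_fin sqr_ge0.
rewrite ge0_integral_sum//; last 2 first.
- by move=> j; apply/measurable_EFinP; exact: measurable_funX.
- by move=> j w _; rewrite lee_fin sqr_ge0.
under eq_bigr do rewrite second_moment.
rewrite sumEFin sumr_const card_ord -EFinM -[in RHS](mulKf (x := N%:R) _ r).
  by rewrite mulr_natl.
by rewrite pnatr_eq0 -lt0n.
Qed.

End measurable_filter.

(** * Moments of the imaginary perturbed observations variance, compared with the square-root
    update *)

Theorem mainTheorem8 (d : measure_display) (T : measurableType d)
    (R : realType) (Pr : probability T R)
    (m : nat -> R) (r p0 : R) (N i : nat)
    (hm : forall j, m j != 0) (hr : 0 < r) (hp0 : 0 < p0) (hN : (1 < N)%N)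
    (a0 xi : {RV Pr >-> N.-tuple R}) :
  let a := fun w : T => forecast r m i (a0 w) in
  let K := fun w : T => gain r (a w) in
  let Rs := fun w : T => sample_var (xi w) in
  let P := fun w : T => complex_sample_var (ipo_analysis r (a w) (xi w)) in
  iid_normal Pr p0 a0 ->
  iid_normal Pr r xi ->
  independent Pr a xi ->
  [/\ (forall w, P w = r * K w + K w ^+ 2 * (Rs w - r)),
      ('E_Pr[P] = r%:E * 'E_Pr[K])%E,
      ('V_Pr[P] = (r ^+ 2)%:E * 'V_Pr[K]
         + 'E_Pr[fun w => (K w ^+ 4)%R] * 'E_Pr[fun w => ((Rs w - r) ^+ 2)%R])%E,
      ('E_Pr[P] = 'E_Pr[fun w => analysis_var r (a w)])%E
    & ('V_Pr[P] = 'V_Pr[fun w => analysis_var r (a w)]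
         + 'E_Pr[fun w => (K w ^+ 4)%R] * 'E_Pr[fun w => ((Rs w - r) ^+ 2)%R])%E].
Proof.
move=> a K Rs P _ xi_normal ind.
have ma : measurable_fun setT a.
  apply: measurableT_comp (measurable_forecast _ _ hr) _.
  exact: measurable_funP.
(* The forecast is packaged as a random variable so that the noise lemmas apply, with [gain r] for
   [f], [sample_var] for [g] and [r] for [c]. *)
pose A : {RV Pr >-> N.-tuple R} := mfun_Sub (mem_set ma).
have PE w : P w = r * K w + K w ^+ 2 * (Rs w - r) by exact: ipo_analysis_varE.
have varE : (fun w => analysis_var r (a w)) = (fun w => r * K w).
  by apply/funext => w; exact: analysis_varE.
have ER := expectation_sample_var hr (ltnW hN) xi_normal.
have mg := @measurable_gain R N r hr.
have g01 (x : N.-tuple R) := gain_itv x hr.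
have mv := @measurable_sample_var R N.
have v0 := @sample_var_ge0 R N.
have iK : Pr.-integrable setT (EFin \o K) :=
  @integrable_pow_bounded _ _ _ _ _ Pr A _ mg g01 1.
have EP : ('E_Pr[P] = r%:E * 'E_Pr[K])%E.
  rewrite (funext PE).
  exact: (@expectation_multiplicative_noise _ _ _ _ _ _ _ Pr A xi _ _ _
    ind mg mv g01 v0 ER).
have VP : ('V_Pr[P] = (r ^+ 2)%:E * 'V_Pr[K] +
    'E_Pr[fun w => (K w ^+ 4)%R] * 'E_Pr[fun w => ((Rs w - r) ^+ 2)%R])%E.
  rewrite (funext PE).
  exact: (@variance_multiplicative_noise _ _ _ _ _ _ _ Pr A xi _ _ _
    ind mg mv g01 v0 ER).
split => //.
- by rewrite varE expectation_scale.
- by rewrite varE variance_scale.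
Qed.
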